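(* Let $X$ be a Banach space. Then the following assertions are equivalent: (1) $X$ has the L-Dunford-Pettis property; (2) for each Banach space $Y$, every Dunford-Pettis completely continuous operator from $X$ into $Y$ is weakly compact; (3) every Dunford-Pettis completely continuous operator from $X$ into $\ell^{\infty}$ is weakly compact.
   Context: $X'$ denotes the topological dual of the Banach space $X$; operators are bounded linear operators; $\ell^\infty$ is the Banach space of all bounded sequences. A norm bounded subset $A$ of a Banach space $X$ is called Dunford-Pettis (DP) if every weakly null sequence $(f_n)$ in $X'$ converges uniformly to zero on $A$, i.e. $\lim_{n\to\infty}\sup_{x\in A}|f_n(x)|=0$. A sequence $(x_n)$ ''is a DP set'' if the set $\{x_n : n\in\mathbb{N}\}$ is a DP set. An operator $T:X\to Y$ between Banach spaces is Dunford-Pettis completely continuous (DPcc) if it maps every weakly null sequence in $X$ which is a DP set in $X$ to a norm null sequence in $Y$. A norm bounded subset $A$ of $X'$ is called an L-Dunford-Pettis set if every weakly null sequence $(x_n)$ in $X$ which is a DP set in $X$ satisfies $\lim_{n\to\infty}\sup_{f\in A}|f(x_n)|=0$. A Banach space $X$ has the L-Dunford-Pettis property if every L-Dunford-Pettis set in $X'$ is relatively weakly compact. *)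

(* Defs.v *)
From HB Require Import structures.
From mathcomp Require Import all_boot all_order all_algebra.
From mathcomp Require Import all_classical all_reals all_analysis.

Set Implicit Arguments.
Unset Strict Implicit.
Unset Printing Implicit Defensive.

Import Order.TTheory GRing.Theory Num.Theory.
Import numFieldNormedType.Exports.

Local Open Scope classical_set_scope.
Local Open Scope ring_scope.

Section BoundedOperators.
Context {R : realType} {V W : normedModType R}.
Implicit Types f g : V -> W.

Definition bounded_linear f : Prop :=
  linear f /\ exists M : R, forall x, `|f x| <= M * `|x|.

Definition bounded_linear_pred : pred (V -> W) := mem [set f | bounded_linear f].

Lemma bounded_linear_submod : submod_closed bounded_linear_pred.
Proof.
split=> [|a f g /set_mem [lf [M fM]] /set_mem [lg [N gN]]]; apply: mem_set.
  split=> [k u v|]; first by rewrite scaler0 addr0.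
  by exists 0 => x; rewrite normr0 mul0r.
split=> [k u v|].
  rewrite /= !fctE lf lg !scalerDr !scalerA [a * k]mulrC.
  by rewrite addrACA.
exists (`|a| * M + N) => x; rewrite !fctE mulrDl -mulrA.
by rewrite (le_trans (ler_normD _ _))// normrZ lerD// ler_wpM2l.
Qed.

End BoundedOperators.

Record bounded_op (R : realType) (V W : normedModType R) := BoundedOp {
  bounded_op_fun :> V -> W ;
  bounded_opP : bounded_op_fun \in @bounded_linear_pred R V W }.

HB.instance Definition _ (R : realType) (V W : normedModType R) :=
  GRing.isSubmodClosed.Build _ _ (@bounded_linear_pred R V W)
    bounded_linear_submod.

HB.instance Definition _ (R : realType) (V W : normedModType R) :=
  [isSub for @bounded_op_fun R V W].

HB.instance Definition _ (R : realType) (V W : normedModType R) :=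
  [Choice of bounded_op V W by <:].

HB.instance Definition _ (R : realType) (V W : normedModType R) :=
  [SubChoice_isSubLmodule of bounded_op V W by <:].

Section OperatorNorm.
Context {R : realType} {V W : normedModType R}.
Implicit Types f g : bounded_op V W.

Lemma bounded_op_linear f : linear f.
Proof. by have /set_mem [] := bounded_opP f. Qed.

HB.instance Definition _ f :=
  GRing.isLinear.Build R V W *:%R (bounded_op_fun f) (bounded_op_linear f).

Definition op_norm f : R := sup [set `|f x| | x in [set x | `|x| <= 1]].

Lemma op_norm_has_sup f : has_sup [set `|f x| | x in [set x | `|x| <= 1]].
Proof.
split; first by exists `|f 0|, 0 => //=; rewrite normr0.
have /set_mem [_ [M fM]] := bounded_opP f.
exists `|M| => _ [x /= x1 <-].
rewrite (le_trans (fM x))// (le_trans (ler_norm _))// normrM normr_id.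
by rewrite ler_piMr.
Qed.

Lemma le_op_norm f x : `|f x| <= op_norm f * `|x|.
Proof.
have [->|x0] := eqVneq x 0; first by rewrite linear0 !normr0 mulr0.
have nx : 0 < `|x| by rewrite normr_gt0.
have : `|f (`|x|^-1 *: x)| <= op_norm f.
  apply: (sup_upper_bound (op_norm_has_sup f)); exists (`|x|^-1 *: x) => //=.
  by rewrite normrZ normfV normr_id mulVf ?gt_eqF.
by rewrite linearZ/= normrZ normfV normr_id ler_pdivrMl // mulrC.
Qed.

Lemma op_norm_le f M : (forall x, `|x| <= 1 -> `|f x| <= M) -> op_norm f <= M.
Proof.
move=> fM; apply: ge_sup; first by have [] := op_norm_has_sup f.
by move=> _ [x /= x1 <-]; exact: fM.
Qed.

Lemma op_normD f g : op_norm (f + g) <= op_norm f + op_norm g.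
Proof.
apply: op_norm_le => x x1; rewrite (le_trans (ler_normD _ _))// lerD//.
  by apply: (sup_upper_bound (op_norm_has_sup f)); exists x.
by apply: (sup_upper_bound (op_norm_has_sup g)); exists x.
Qed.

Lemma op_normZ (a : R) f : op_norm (a *: f) = `|a| * op_norm f.
Proof.
have leZ b h : op_norm (b *: h) <= `|b| * op_norm h.
  apply: op_norm_le => x x1; rewrite [_ x](_ : _ = b *: h x)// normrZ.
  rewrite ler_wpM2l//.
  by apply: (sup_upper_bound (op_norm_has_sup h)); exists x.
apply/eqP; rewrite eq_le leZ/=; have [->|a0] := eqVneq a 0.
  rewrite normr0 mul0r (le_trans (normr_ge0 ((0 *: f) 0)))//.
  apply: (sup_upper_bound (op_norm_has_sup _)).
  by exists 0 => //=; rewrite normr0.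
rewrite -ler_pdivlMl ?normr_gt0// -normfV.
by rewrite -[X in op_norm X <= _](scale1r f) -(mulVf a0) -scalerA.
Qed.

Lemma op_norm_eq0 f : op_norm f = 0 -> f = 0.
Proof.
move=> f0; apply/val_inj/funext => x; apply/eqP; rewrite -normr_le0.
by have := le_op_norm f x; rewrite f0 mul0r.
Qed.

HB.instance Definition _ :=
  Lmodule_isNormed.Build R (bounded_op V W) op_normD op_normZ op_norm_eq0.

End OperatorNorm.

Definition dual (R : realType) (V : normedModType R) : normedModType R :=
  bounded_op V R^o.

(* The weak topology sigma(V, V'): the coarsest topology on V for which every
   functional in V' is continuous. *)
Definition weak_topology (R : realType) (V : normedModType R) :
    topologicalType :=
  sup_topology (fun f : dual V =>
    Topological.class (initial_topology (f : V -> R^o))).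

Section DunfordPettis.
Context {R : realType}.
Implicit Types V W : normedModType R.

Definition weakly_null V (x : nat -> V) : Prop :=
  x @ \oo --> ((0 : V) : weak_topology V).

Definition relatively_weakly_compact V (A : set V) : Prop :=
  @precompact (weak_topology V) A.

Definition weakly_compact_op V W (T : bounded_op V W) : Prop :=
  relatively_weakly_compact (T @` [set x | `|x| <= 1]).

(* The suprema below are over bounded sets of nonnegative reals, so that the
   real-valued [sup] is the intended one ([sup set0 = 0] when A is empty). *)
Definition DP_set V (A : set V) : Prop :=
  bounded_set A /\
  forall f : nat -> dual V, weakly_null f ->
    sup [set `|f n x| | x in A] @[n --> \oo] --> (0 : R).

Definition DPcc V W (T : bounded_op V W) : Prop :=
  forall x : nat -> V, weakly_null x -> DP_set (range x) ->
    T (x n) @[n --> \oo] --> (0 : W).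

Definition LDP_set V (A : set (dual V)) : Prop :=
  bounded_set A /\
  forall x : nat -> V, weakly_null x -> DP_set (range x) ->
    sup [set `|f (x n)| | f in A] @[n --> \oo] --> (0 : R).

Definition LDP_property V : Prop :=
  forall A : set (dual V), LDP_set A -> relatively_weakly_compact A.

End DunfordPettis.

Section EllInfty.
Context {R : realType}.

Definition bounded_seq_pred : pred (nat -> R^o) := mem [set x | bounded_fun x].

Lemma bounded_seqP (x : nat -> R^o) :
  (x \in bounded_seq_pred) <-> exists M : R, forall n, `|x n| <= M.
Proof.
have FF : ProperFilter (globally [set: nat]).
  exact: (@globally_properfilter _ _ 0%N).
split=> [/set_mem xb|[M xM]].
  have [M xM] := (@ex_bound _ _ _ x _ FF).1 xb.
  by exists M => n; exact: xM.
by apply/mem_set/(@ex_bound _ _ _ x _ FF); exists M => n _; exact: xM.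
Qed.

Lemma bounded_seq_submod : submod_closed bounded_seq_pred.
Proof.
split=> [|a x y /bounded_seqP [M xM] /bounded_seqP [N yN]];
  apply/bounded_seqP.
  by exists 0 => n; rewrite normr0.
exists (`|a| * M + N) => n; rewrite !fctE.
by rewrite (le_trans (ler_normD _ _))// normrZ lerD// ler_wpM2l.
Qed.

End EllInfty.

Record ell_infty (R : realType) := EllInfty {
  ell_infty_seq :> nat -> R^o ;
  ell_inftyP : ell_infty_seq \in @bounded_seq_pred R }.

HB.instance Definition _ (R : realType) :=
  GRing.isSubmodClosed.Build _ _ (@bounded_seq_pred R) bounded_seq_submod.

HB.instance Definition _ (R : realType) := [isSub for @ell_infty_seq R].

HB.instance Definition _ (R : realType) := [Choice of ell_infty R by <:].

HB.instance Definition _ (R : realType) :=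
  [SubChoice_isSubLmodule of ell_infty R by <:].

Section SupNorm.
Context {R : realType}.
Implicit Types x y : ell_infty R.

Definition sup_norm x : R := sup (range (fun n => `|x n|)).

Lemma sup_norm_has_sup x : has_sup (range (fun n => `|x n|)).
Proof.
split; first by exists `|x 0%N|, 0%N.
have /bounded_seqP [M xM] := ell_inftyP x.
by exists M => _ [n _ <-].
Qed.

Lemma le_sup_norm x n : `|x n| <= sup_norm x.
Proof. by apply: (sup_upper_bound (sup_norm_has_sup x)); exists n. Qed.

Lemma sup_norm_le x M : (forall n, `|x n| <= M) -> sup_norm x <= M.
Proof.
move=> xM; apply: ge_sup; first by have [] := sup_norm_has_sup x.
by move=> _ [n _ <-].
Qed.

Lemma sup_normD x y : sup_norm (x + y) <= sup_norm x + sup_norm y.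
Proof.
apply: sup_norm_le => n; rewrite (le_trans (ler_normD _ _))//.
by rewrite lerD// le_sup_norm.
Qed.

Lemma sup_normZ (a : R) x : sup_norm (a *: x) = `|a| * sup_norm x.
Proof.
have leZ b z : sup_norm (b *: z) <= `|b| * sup_norm z.
  apply: sup_norm_le => n; rewrite [X in `|X|](_ : _ = b *: z n)// normrZ.
  by rewrite ler_wpM2l// le_sup_norm.
apply/eqP; rewrite eq_le leZ/=; have [->|a0] := eqVneq a 0.
  by rewrite normr0 mul0r (le_trans _ (le_sup_norm _ 0%N)).
rewrite -ler_pdivlMl ?normr_gt0// -normfV.
by rewrite -[X in sup_norm X <= _](scale1r x) -(mulVf a0) -scalerA.
Qed.

Lemma sup_norm_eq0 x : sup_norm x = 0 -> x = 0.
Proof.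
move=> x0; apply/val_inj/funext => n; apply/eqP; rewrite -normr_le0.
by rewrite -x0 le_sup_norm.
Qed.

HB.instance Definition _ :=
  Lmodule_isNormed.Build R (ell_infty R) sup_normD sup_normZ sup_norm_eq0.

Lemma ell_infty_complete (F : set_system (ell_infty R)) :
  ProperFilter F -> cauchy F -> cvg F.
Proof.
move=> FF /cauchy_ballP Fc.
have Fn n : cvg ((fun x : ell_infty R => x n) @ F).
  apply/cauchy_cvgP/cauchy_ballP => e e0; have [[/= A B] [FA FB] AB] := Fc e e0.
  exists ((fun x : ell_infty R => x n) @` A, (fun x : ell_infty R => x n) @` B).
    by split; [apply: (filterS _ FA)|apply: (filterS _ FB)] => x ?; exists x.
  move=> [_ _] [/= [x Ax <-] [y By <-]].
  have := AB (x, y) (conj Ax By).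
  rewrite -!ball_normE /=; apply: le_lt_trans.
  by rewrite [leLHS](_ : _ = `|(x - y) n|)// le_sup_norm.
pose l n : R^o := lim ((fun x : ell_infty R => x n) @ F).
have near_l e : 0 < e ->
    \forall x \near F, forall n, `|l n - (x : ell_infty R) n| <= e.
  move=> e0; have [[/= A B] [FA FB] AB] := Fc e e0.
  apply: (filterS _ FA) => x Ax n; rewrite distrC.
  have cxy : `|x n - (y : ell_infty R) n| @[y --> F] --> `|x n - l n|.
    by apply: cvg_norm; apply: cvgB; [exact: cvg_cst|exact: Fn].
  rewrite -(cvg_lim _ cxy)//; apply: limr_le; first exact: (cvgP _ cxy).
  apply: (filterS _ FB) => y By.
  have := AB (x, y) (conj Ax By); rewrite -ball_normE /= => /ltW.
  by apply: le_trans; rewrite [leLHS](_ : _ = `|(x - y) n|)// le_sup_norm.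
have lb : l \in bounded_seq_pred.
  have [x xl] := filter_ex (near_l 1 ltr01).
  apply/bounded_seqP; exists (1 + sup_norm x) => n.
  rewrite -(subrK (x n) (l n)) (le_trans (ler_normD _ _))//.
  by rewrite lerD// le_sup_norm.
apply/cvg_ex; exists (EllInfty lb); apply/cvgrPdist_le => e e0.
apply: (filterS _ (near_l e e0)) => x xl.
by apply: sup_norm_le => n; exact: xl.
Qed.

HB.instance Definition _ := Uniform_isComplete.Build (ell_infty R)
  ell_infty_complete.

End SupNorm.

(* Main.v *)
Require Import Defs.
From mathcomp Require Import all_boot all_order all_algebra.
From mathcomp Require Import all_classical all_reals all_analysis.
From mathcomp Require Import lra ring.

Set Implicit Arguments.
Unset Strict Implicit.
Unset Printing Implicit Defensive.

Import Order.TTheory GRing.Theory Num.Theory.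
Import numFieldNormedType.Exports.

Local Open Scope classical_set_scope.
Local Open Scope ring_scope.

(** The equivalence rests on two facts about weak compactness.

    First, an operator [T : X -> Y] into a Banach space is weakly compact as
    soon as its adjoint maps the dual ball to a relatively weakly compact set
    ([weakly_compact_of_adjoint]). When [T] is Dunford-Pettis completely
    continuous, that image of the dual ball is an L-Dunford-Pettis set,
    because the supremum over it of the values at [x n] is at most the norm of
    [T (x n)]; so the first assertion implies the second, of which the third
    is a special case. To prove the fact, let [g] in the bidual of [Y] be the
    limit of the [T x] along an ultrafilter on the ball of [X]. If [g] had
    distance more than [d] from [Y], Helly's theorem in the dual of [Y] would
    give functionals [f] of the dual ball with [g f] tending to [d] and
    [f (T x)] tending to [0] for every [x]; a weak limit [h] of their adjoint images
    vanishes on [X], yet the limit in the bidual of [X] of the evaluations at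
    the points of the ball, which induces [g], takes the value [d] at [h]. So
    [g] is a limit of elements of [Y], and belongs to [Y] by completeness.

    Secondly, a bounded set [A] of functionals on [X] is relatively weakly
    compact as soon as every sequence [f n] in [A] defines a weakly compact
    operator [x |-> (f n x)_n] into the bounded sequences; this operator is
    Dunford-Pettis completely continuous when [A] is an L-Dunford-Pettis set,
    so the third assertion implies the first. To prove the fact, take an
    ultrafilter on [A], let [f0] be its pointwise limit on [X], and suppose
    that at some [phi] in the bidual ball the limit [l] of the [phi f] differs
    from [phi f0]. [goldstine] and an alternating choice give [x m] in the
    ball of [X] and [f n] in [A] whose iterated limits are [phi f0] and [l]
    ([interlaced_sequences]). A weak limit [z] of the [T (x m)] has
    coordinates [phi (f n)]; evaluating at [z] the functional that takes
    limits of bounded sequences along an ultrafilter gives [l], and by weak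
    convergence it also gives [phi f0].

    Both arguments use Helly's theorem ([helly]), proved by minimising a sum
    of squares over the ball. The Hahn-Banach theorem is only needed to know
    that a Banach space is closed in its bidual ([bidual_closed]). *)

(** * Bounded functionals *)

Lemma dual_build (R : realType) (V : normedModType R) (f : V -> R) (M : R) :
  (forall x y, f (x + y) = f x + f y) -> (forall a x, f (a *: x) = a * f x) ->
  (forall x, `|f x| <= M * `|x|) -> exists g : dual V, forall x, g x = f x.
Proof.
move=> fD fZ fM.
have fP : (f : V -> R^o) \in @bounded_linear_pred R V R^o.
  by apply: mem_set; split; [move=> a x y; rewrite fD fZ|exists M].
by exists (BoundedOp fP).
Qed.

(** * The Hahn-Banach theorem *)

Section HahnBanach.
Context {R : realType} {V : normedModType R}.
Implicit Types (p q : V -> R) (x y v : V) (t : R).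

(** Subadditive and positively homogeneous. *)
Definition sublinear p : Prop :=
  (forall x y, p (x + y) <= p x + p y) /\
  (forall t x, 0 <= t -> p (t *: x) = t * p x).

Lemma sublinearP p : (forall x y, p (x + y) <= p x + p y) ->
  (forall t x, 0 < t -> p (t *: x) <= t * p x) -> p 0 = 0 -> sublinear p.
Proof.
move=> pD pZ p0; split=> // t x; rewrite le_eqVlt => /predU1P[<-|t0].
  by rewrite scale0r mul0r.
apply/eqP; rewrite eq_le pZ//=.
have ti : 0 < t^-1 by rewrite invr_gt0.
have := pZ t^-1 (t *: x) ti.
by rewrite scalerA mulVf ?gt_eqF// scale1r -ler_pdivrMl ?invr_gt0// invrK.
Qed.

Lemma sublinear0 p : sublinear p -> p 0 = 0.
Proof. by move=> [_ pZ]; rewrite -[in LHS](scale0r 0) pZ// mul0r. Qed.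

Lemma sublinearN p x : sublinear p -> - p (- x) <= p x.
Proof.
move=> ps; have := ps.1 x (- x); rewrite subrr sublinear0//.
by rewrite -subr_ge0 => h; rewrite -subr_ge0 opprK; move: h; lra.
Qed.

Lemma sublinear_norm : sublinear (fun x => `|x|).
Proof.
by split=> [x y|t x t0]; [exact: ler_normD|rewrite normrZ ger0_norm].
Qed.

(** The largest sublinear minorant of [p] whose value at [- x] is at most
    [- p x]. *)
Definition shave p x v : R :=
  inf [set p (v + t *: x) - t * p x | t in [set t | 0 <= t]].

Lemma shave_has_inf p x v : sublinear p ->
  has_inf [set p (v + t *: x) - t * p x | t in [set t | 0 <= t]].
Proof.
move=> ps; split; first by exists (p (v + 0 *: x) - 0 * p x), 0 => //=.
exists (- p (- v)) => _ [t /= t0 <-].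
have := ps.1 (v + t *: x) (- v); rewrite addrAC subrr add0r ps.2//; lra.
Qed.

Lemma shave_le p x v t : sublinear p -> 0 <= t ->
  shave p x v <= p (v + t *: x) - t * p x.
Proof.
by move=> ps t0; apply: ge_inf; [exact: (shave_has_inf x v ps).2|exists t].
Qed.

Lemma shave_ge p x v c : sublinear p ->
  (forall t, 0 <= t -> c <= p (v + t *: x) - t * p x) -> c <= shave p x v.
Proof.
move=> ps h; apply: lb_le_inf; first exact: (shave_has_inf x v ps).1.
by move=> _ [t /= t0 <-]; exact: h.
Qed.

Lemma shave_le_self p x v : sublinear p -> shave p x v <= p v.
Proof.
move=> ps; have := shave_le x v ps (lexx 0).
by rewrite scale0r addr0 mul0r subr0.
Qed.

Lemma shaveN p x : sublinear p -> shave p x (- x) <= - p x.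
Proof.
move=> ps; have := shave_le x (- x) ps ler01.
by rewrite scale1r addNr mul1r sublinear0// sub0r.
Qed.

Lemma shave_sublinear p x : sublinear p -> sublinear (shave p x).
Proof.
move=> ps; apply: sublinearP => [u v|t v t0|].
- (* the bound with parameter s + t is at most the sum of those with s and t *)
  rewrite -lerBlDr; apply: (shave_ge ps) => s s0.
  rewrite lerBlDr -lerBlDl; apply: (shave_ge ps) => t t0.
  have := shave_le x (u + v) ps (addr_ge0 s0 t0).
  have := ps.1 (u + s *: x) (v + t *: x).
  by rewrite addrACA -scalerDl; lra.
- rewrite -ler_pdivrMl//; apply: (shave_ge ps) => s s0.
  rewrite ler_pdivrMl//.
  have := shave_le x (t *: v) ps (mulr_ge0 (ltW t0) s0).
  by rewrite -scalerA -scalerDr ps.2 ?(ltW t0)// mulrBr mulrA.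
- apply/eqP; rewrite eq_le; apply/andP; split.
    by rewrite -(sublinear0 ps); exact: shave_le_self.
  by apply: (shave_ge ps) => t t0; rewrite add0r ps.2// subrr.
Qed.

(** By Zorn's lemma: the pointwise infimum of a chain of sublinear functionals
    is sublinear. *)
Lemma minimal_sublinear p : sublinear p ->
  exists q, [/\ sublinear q, forall x, q x <= p x &
    forall r, sublinear r -> (forall x, r x <= q x) -> r = q].
Proof.
move=> ps; pose T := {q | sublinear q /\ forall x, q x <= p x}.
pose below (a b : T) := `[< forall x, sval b x <= sval a x >].
have p0 : sublinear p /\ forall x, p x <= p x by [].
have [|||[q [qs qp]] qmin] := @ZL_preorder T (exist _ p p0) below.
- by move=> a; apply/asboolP.
- move=> b a c /asboolP ab /asboolP bc; apply/asboolP => x.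
  exact: le_trans (bc x) (ab x).
- move=> A Atot.
  have [[a0 Aa0]|A0] := pselect (exists a, A a); last first.
    by exists (exist _ p p0) => s As; exfalso; apply: A0; exists s.
  pose S x := [set sval (a : T) x | a in A].
  have Sinf x : has_inf (S x).
    split; first by exists (sval a0 x), a0.
    exists (- p (- x)) => _ [[a [sa ap]] _ <-] /=.
    by apply: le_trans (sublinearN x sa); rewrite lerN2.
  have Sle a x : A a -> inf (S x) <= sval a x.
    by move=> Aa; apply: ge_inf; [exact: (Sinf x).2|exists a].
  have Sge c x : (forall a, A a -> c <= sval a x) -> c <= inf (S x).
    move=> h; apply: lb_le_inf; first exact: (Sinf x).1.
    by move=> _ [a Aa <-]; exact: h.
  have iP : sublinear (fun x => inf (S x)) /\ forall x, inf (S x) <= p x.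
    split; last by move=> x; exact: le_trans (Sle _ x Aa0) ((svalP a0).2 x).
    apply: sublinearP => [x y|t x t0|].
    + rewrite -lerBlDr; apply: (Sge _ _) => a Aa.
      rewrite lerBlDr -lerBlDl; apply: (Sge _ _) => b Ab.
      (* the smaller of two elements of the chain handles both summands *)
      wlog /asboolP ab : a b x y Aa Ab / below a b => [wl|].
        have [/wl|/wl] := Atot _ _ Aa Ab; first exact.
        by move=> /(_ y x Ab Aa); rewrite [y + x]addrC; lra.
      have := Sle _ (x + y) Ab; have := (svalP b).1.1 x y; have := ab x; lra.
    + rewrite -ler_pdivrMl//; apply: (Sge _ _) => a Aa; rewrite ler_pdivrMl//.
      by rewrite -(svalP a).1.2 ?(ltW t0)//; exact: Sle.
    + apply/eqP; rewrite eq_le -{1}(sublinear0 (svalP a0).1) Sle//=.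
      by apply: (Sge _ _) => a Aa; rewrite (sublinear0 (svalP a).1).
  exists (exist _ (fun x => inf (S x)) iP) => s As; apply/asboolP => x /=.
  exact: Sle.
- exists q; split=> // r rs rq; apply/funext => x; apply/eqP.
  rewrite eq_le rq/=.
  have rp : sublinear r /\ forall x, r x <= p x.
    by split=> // y; exact: le_trans (rq y) (qp y).
  have qr : below (exist _ q (conj qs qp)) (exist _ r rp) by apply/asboolP.
  by have /asboolP := qmin _ qr; exact.
Qed.

(** A minimal sublinear functional is its own [shave] in every direction, so
    it is odd, and a sublinear odd functional is linear. *)
Theorem norming_functional x : exists f : dual V,
  (forall v, `|f v| <= `|v|) /\ f x = `|x|.
Proof.
have ns := sublinear_norm.
have [q [qs qn qmin]] := minimal_sublinear (shave_sublinear x ns).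
have qN v : q (- v) = - q v.
  have sq : shave q v = q.
    apply: qmin; first exact: shave_sublinear.
    by move=> u; exact: shave_le_self.
  apply/eqP; rewrite eq_le -{1}sq shaveN//=.
  by have := sublinearN (- v) qs; rewrite opprK.
have qle v : q v <= `|v| := le_trans (qn v) (shave_le_self _ _ ns).
have [|||f fq] := @dual_build _ V q 1.
- move=> u v; apply/eqP; rewrite eq_le qs.1/=.
  by have := qs.1 (- u) (- v); rewrite -opprD !qN; lra.
- move=> a v; have [a0|a0] := leP 0 a; first exact: qs.2.
  by rewrite -[in LHS](opprK a) scaleNr qN qs.2 ?oppr_ge0 ?(ltW a0)//; ring.
- move=> v; rewrite mul1r ler_norml qle andbT lerNl -qN -[leRHS]normrN.
  exact: qle.
exists f; split=> [v|].
  rewrite fq ler_norml qle andbT lerNl -qN -[leRHS]normrN.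
  exact: qle.
apply/eqP; rewrite eq_le fq qle/= -lerN2 -qN.
exact: le_trans (qn (- x)) (shaveN x ns).
Qed.

End HahnBanach.

(** * Helly's theorem *)

Section Helly.
Context {R : realType} {V : normedModType R}.

Lemma dual_sumE (J : Type) (s : seq J) (a : J -> R) (k : J -> dual V) (x : V) :
  (\sum_(j <- s) a j *: k j : dual V) x = \sum_(j <- s) a j * k j x.
Proof. by elim/big_rec2 : _ => // j u f _ <-. Qed.

Lemma le_dual_norm (f : dual V) x : `|f x| <= `|f| * `|x|.
Proof. exact: le_op_norm. Qed.

Lemma dual_norm_le (f : dual V) (M : R) :
  (forall x, `|x| <= 1 -> f x <= M) -> `|f| <= M.
Proof.
move=> fM; apply: op_norm_le => x x1; rewrite ler_norml fM// andbT lerNl.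
by rewrite -linearN fM// normrN.
Qed.

(** If [c] satisfies the bounds that the values of the functionals [k j] at a
    point of the unit ball must satisfy, then it is approximated by such
    values. The point minimises, up to a small error, the sum [Q] of the squared
    deviations, and the first-order condition at that point is a bound on the
    norm of a combination of the [k j]. *)
Lemma helly (J : eqType) (s : seq J) (k : J -> dual V) (c : J -> R) :
  (forall a : J -> R,
     \sum_(j <- s) a j * c j <= `|\sum_(j <- s) a j *: k j|) ->
  forall e : R, 0 < e ->
  exists x, `|x| <= 1 /\ forall j, j \in s -> `|k j x - c j| <= e.
Proof.
move=> H e e0; pose Q x := \sum_(j <- s) (k j x - c j) ^+ 2.
pose E := [set Q x | x in [set x | `|x| <= 1]].
have Q0 x : 0 <= Q x by apply: sumr_ge0 => j _; exact: sqr_ge0.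
have infE : has_inf E.
  split; first by exists (Q 0), 0 => //=; rewrite normr0.
  by exists 0 => _ [x _ <-].
pose N := \sum_(j <- s) (`|k j| * 2) ^+ 2.
have N0 : 0 <= N by apply: sumr_ge0 => j _; exact: sqr_ge0.
have [eps eps0 epsE] : exists2 eps : R, 0 < eps & eps = e ^+ 2.
  by exists (e ^+ 2); rewrite ?exprn_gt0.
(* moving by the fraction t towards any point of the ball cannot lower Q by
   more than t * eps, and its second-order term is at most t ^ 2 * N *)
have [t [t0 t1 tN]] : exists t : R, [/\ 0 < t, t <= 1 & t * N <= eps].
  have D0 : 0 < N + 1 + eps by lra.
  exists (eps / (N + 1 + eps)); split; first by rewrite divr_gt0.
    by rewrite ler_pdivrMr//; lra.
  by rewrite mulrAC ler_pdivrMr// ler_wpM2l ?(ltW eps0)//; lra.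
have [_ [x0 /= x01 <-] Qx0] := inf_adherent (mulr_gt0 t0 eps0) infE.
pose w j := k j x0 - c j.
have step x : `|x| <= 1 ->
    - eps <= \sum_(j <- s) w j * k j x - \sum_(j <- s) w j * k j x0.
  move=> x1; pose y := x0 + t *: (x - x0).
  have y1 : `|y| <= 1.
    have -> : y = (1 - t) *: x0 + t *: x.
      by rewrite /y scalerBr scalerBl scale1r addrCA addrC.
    rewrite (le_trans (ler_normD _ _))// !normrZ.
    rewrite !ger0_norm ?subr_ge0 ?(ltW t0)// -[leRHS](subrK t) lerD//.
      by rewrite ler_piMr// subr_ge0.
    by rewrite ler_piMr// ltW.
  have Qy : inf E <= Q y by apply: ge_inf; [exact: infE.2|exists y].
  have : Q y <= \sum_(j <- s) ((k j x0 - c j) ^+ 2 +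
      (t * 2) * (w j * k j x - w j * k j x0) + t ^+ 2 * (`|k j| * 2) ^+ 2).
    apply: ler_sum => j _; rewrite /y linearD linearZ linearB/=.
    rewrite -[_ *: _]/(_ * _).
    have kx : (k j x - k j x0) ^+ 2 <= (`|k j| * 2) ^+ 2.
      rewrite -linearB -[leLHS]real_normK ?num_real//.
      rewrite lerXn2r ?nnegrE ?mulr_ge0// (le_trans (le_dual_norm _ _))//.
      rewrite ler_wpM2l// (le_trans (ler_normB _ _))//; lra.
    have : t ^+ 2 * (k j x - k j x0) ^+ 2 <= t ^+ 2 * (`|k j| * 2) ^+ 2.
      by rewrite ler_wpM2l// sqr_ge0.
    by rewrite /w; lra.
  rewrite !big_split/= -!mulr_sumr sumrB -/(Q x0) -/N => Qle.
  have : t * (- eps * 2) <= t * (2 * (\sum_(j <- s) w j * k j x -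
      \sum_(j <- s) w j * k j x0)).
    by have : t * (t * N) <= t * eps by [rewrite ler_wpM2l// ltW|]; lra.
  by rewrite ler_pM2l//; lra.
have Hw : `|\sum_(j <- s) - w j *: k j| <=
    eps - \sum_(j <- s) w j * k j x0.
  apply: dual_norm_le => x /step; rewrite dual_sumE.
  under [in X in _ -> X]eq_bigr do rewrite mulNr.
  by rewrite sumrN; lra.
have Qe : Q x0 <= eps.
  have := le_trans (H (fun j => - w j)) Hw.
  under eq_bigr do rewrite mulNr; rewrite sumrN => h.
  have -> : Q x0 = \sum_(j <- s) w j * k j x0 - \sum_(j <- s) w j * c j.
    by rewrite -sumrB; apply: eq_bigr => j _; rewrite /w; ring.
  by move: h; lra.
exists x0; split=> // j js.
have : (k j x0 - c j) ^+ 2 <= e ^+ 2.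
  rewrite -epsE; apply: le_trans Qe; rewrite /Q (big_rem j)//= lerDl.
  by apply: sumr_ge0 => i _; exact: sqr_ge0.
by rewrite -[leLHS]real_normK ?num_real// ler_sqr ?nnegrE// ltW.
Qed.

End Helly.

(** * Ultrafilters *)

Section Ultrafilters.
Context {R : realType}.

Lemma ultra_fmap (S T : Type) (u : S -> T) (U : set_system S) :
  UltraFilter U -> UltraFilter (u @ U).
Proof.
move=> UU; have UP : ProperFilter (u @ U) by exact: fmap_proper_filter.
apply: Build_UltraFilter => G GG UG; apply/seteqP; split=> // A GA.
have [//|nA] := in_ultra_setVsetC (u @^-1` A) UU.
have GnA : G (~` A) by exact: UG.
exfalso; apply: (@filter_not_empty _ G).
by rewrite -(setICr A); exact: filterI.
Qed.

Lemma real_cvg_unique (S : Type) (U : set_system S) (u : S -> R) (l l' : R) :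
  ProperFilter U -> u @ U --> l -> u @ U --> l' -> l = l'.
Proof. by move=> UP ul ul'; rewrite -(cvg_lim _ ul)// -(cvg_lim _ ul'). Qed.

Lemma ultra_bounded_cvg (S : Type) (U : set_system S) (u : S -> R) (M : R) :
  UltraFilter U -> U [set s | `|u s| <= M] -> exists l : R, u @ U --> l.
Proof.
move=> UU UM; have := @segment_compact R (- M) M; rewrite compact_ultra.
have UUu := ultra_fmap u UU.
move=> /(_ _ UUu)[|l [_ ul]]; last by exists l.
apply: (@filterS _ U _ _ _ _ UM) => s /=.
by rewrite ler_norml in_itv.
Qed.

(** A bounded family of functionals has a pointwise limit along an
    ultrafilter: the compactness of the dual ball in the weak* topology. *)
Lemma ultra_dual_limit (V : normedModType R) (S : Type) (U : set_system S)
    (F : S -> dual V) (M : R) :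
  UltraFilter U -> U [set s | `|F s| <= M] ->
  exists phi : dual V, forall v, F s v @[s --> U] --> (phi v : R).
Proof.
move=> UU UM.
have UMv v : U [set s | `|F s v| <= M * `|v|].
  apply: (filterS _ UM) => s /= FM.
  by rewrite (le_trans (le_dual_norm _ _))// ler_wpM2r.
have /choice[phi Fphi] v := ultra_bounded_cvg UU (UMv v).
have [||v|f fphi] := @dual_build _ V phi M.
- move=> x y; apply: (real_cvg_unique _ (Fphi (x + y))).
  under eq_cvg do rewrite linearD.
  exact: cvgD (Fphi x) (Fphi y).
- move=> a x; apply: (real_cvg_unique _ (Fphi (a *: x))).
  under eq_cvg do rewrite linearZ.
  exact: cvgMl_tmp (Fphi x).
- rewrite -(cvg_lim _ (cvg_norm (Fphi v)))//.
  apply: limr_le; first exact: cvgP (cvg_norm (Fphi v)).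
  exact: UMv.
by exists f => v; rewrite fphi.
Qed.

(** If functions take values near prescribed ones at points of [B], finitely
    many functions at a time, then they all converge to the prescribed values
    along a single ultrafilter carried by [B]. *)
Lemma ultra_of_approx (S : Type) (J : eqType) (k : J -> S -> R) (c : J -> R)
    (B : set S) :
  (forall (s : seq J) (e : R), 0 < e ->
     exists x, B x /\ forall j, j \in s -> `|k j x - c j| <= e) ->
  exists U : set_system S,
    [/\ UltraFilter U, U B & forall j, k j @ U --> c j].
Proof.
move=> H; pose D := [set i : seq J * R | 0 < i.2].
pose b (i : seq J * R) :=
  [set x | B x /\ forall j, j \in i.1 -> `|k j x - c j| <= i.2].
have FF : Filter (filter_from D b).
  apply: filter_from_filter; first by exists ([::], 1); exact: ltr01.
  move=> [s d] [s' d'] /= d0 d'0; exists (s ++ s', Num.min d d').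
    by rewrite /D /= lt_min d0 d'0.
  move=> x [Bx /= kx]; split; split=> // j js.
    by have := kx j; rewrite mem_cat js le_min => /(_ isT)/andP[].
  by have := kx j; rewrite mem_cat js orbT le_min => /(_ isT)/andP[].
have PF : ProperFilter (filter_from D b).
  apply: filter_from_proper => -[s e] /= e0.
  by have [x Hx] := H s e e0; exists x.
have [U [UU FU]] := ultraFilterLemma PF; exists U; split=> //.
  by apply: FU; exists ([::], 1) => [|x []//]; exact: ltr01.
move=> j; apply/cvgrPdist_le => e e0; apply: FU.
exists ([:: j], e) => // x [_ /= /(_ j)]; rewrite mem_seq1 eqxx => /(_ isT).
by rewrite distrC.
Qed.

End Ultrafilters.

(** * The weak topology *)

Section WeakTopology.
Context {R : realType} {V : normedModType R}.

Lemma weak_cvgP (F : set_system V) (p : V) : Filter F ->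
  (F --> (p : weak_topology V)) <->
  (forall f : dual V, f x @[x --> F] --> (f p : R)).
Proof.
move=> FF; rewrite cvg_sup; split=> [Fp f A Afp|Ff f A].
  exact: (Fp f) (@initial_continuous _ _ (f : V -> R^o) p A Afp).
rewrite nbhsE => -[_ [[B oB <-] Bfp] BA].
by apply: (filterS BA); apply: (Ff f); exact: open_nbhs_nbhs.
Qed.

Lemma weak_continuous (f : dual V) :
  continuous ((f : V -> R^o) : weak_topology V -> R^o).
Proof.
move=> p; pose F := nbhs (p : weak_topology V).
have FF : Filter F by exact: nbhs_filter.
exact: ((weak_cvgP p FF).1 (fun=> id) f).
Qed.

(** Relative weak compactness can be tested on the ultrafilters carried by the
    set itself, without closing it: every point has a base of weak
    neighbourhoods that are weakly closed. *)
Lemma relatively_weakly_compact_image (S : Type) (u : S -> V) (B : set S) :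
  (forall U : set_system S, UltraFilter U -> U B ->
     exists p : V, forall f : dual V, f (u s) @[s --> U] --> (f p : R)) ->
  relatively_weakly_compact (u @` B).
Proof.
move=> H; rewrite /relatively_weakly_compact precompactE compact_ultra.
move=> F FU Fcl.
pose D := [set O : set (weak_topology V) | open O /\ F O].
pose b (O : set (weak_topology V)) := [set s | B s /\ O (u s)].
have bF : Filter (filter_from D b).
  apply: filter_from_filter.
    by exists setT; split; [exact: openT|exact: filterT].
  move=> O O' [oO FO] [oO' FO']; exists (O `&` O').
    by split; [exact: openI|exact: filterI].
  by move=> s [Bs [Os O's]].
have bP : ProperFilter (filter_from D b).
  apply: filter_from_proper => O [oO FO].
  have [p [clp Op]] := filter_ex (filterI Fcl FO).
  have [_ [[s Bs <-] Os]] := clp O (open_nbhs_nbhs (conj oO Op)).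
  by exists s.
(* U is carried by B, and contains the preimages of the open sets of F *)
have [U [UU bU]] := ultraFilterLemma bP.
have [|p up] := H U UU.
  apply: bU; exists setT; last by move=> s [].
  by split; [exact: openT|exact: filterT].
have Fp : F --> (p : weak_topology V).
  apply/weak_cvgP => f; apply/cvgrPdist_le => e e0.
  pose C := [set x : weak_topology V | `|f p - f x| <= e].
  have [//|FnC] := in_ultra_setVsetC C FU; exfalso.
  have oC : open (~` C).
    have -> : ~` C =
        (f : weak_topology V -> R^o) @^-1` [set r | e < `|f p - r|].
      by apply/seteqP; split=> x /=; rewrite /C/= ltNge => /negP.
    apply: open_comp => [x _|]; first exact: weak_continuous.
    have := @open_gt R e; set G := [set x | e < x] => oG.
    apply: (@open_comp _ _ (fun r : R^o => `|f p - r|) G) => // r _.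
    by apply: cvg_norm; apply: cvgB; [exact: cvg_cst|exact: cvg_id].
  have UnC : U [set s | ~ C (u s)] by apply: bU; exists (~` C) => // s [].
  have /cvgrPdist_le/(_ e e0) UC := up f.
  by have [s []] := filter_ex (filterI UnC UC).
exists p; split=> //; apply: closed_closure => N Np.
exact: filter_ex (filterI Fcl (Fp _ Np)).
Qed.

Lemma relatively_weakly_compact_ultra (S : Type) (u : S -> V) (A : set V)
    (U : set_system S) :
  relatively_weakly_compact A -> UltraFilter U -> U (u @^-1` A) ->
  exists p : V, forall f : dual V, f (u s) @[s --> U] --> (f p : R).
Proof.
rewrite /relatively_weakly_compact precompactE compact_ultra => cA UU UA.
have UUu := ultra_fmap u UU.
have [|p [_ Up]] := cA _ UUu.
  apply: (@filterS _ U _ _ _ _ UA) => s As.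
  exact: (@subset_closure (weak_topology V)).
exists p => f; have FF : Filter (u @ U) by exact: fmap_filter.
exact: ((weak_cvgP p FF).1 Up f).
Qed.

End WeakTopology.

(** * Adjoints and evaluations *)

Section Adjoint.
Context {R : realType}.

(** The canonical embedding of a space into its bidual. *)
Lemma evaluation_subproof (V : normedModType R) (v : V) :
  ((fun f : dual V => f v) : dual V -> R^o) \in
  @bounded_linear_pred R (dual V) R^o.
Proof.
apply: mem_set; split; first by [].
by exists `|v| => f; rewrite mulrC; exact: le_dual_norm.
Qed.

Definition evaluation (V : normedModType R) (v : V) : dual (dual V) :=
  BoundedOp (evaluation_subproof v).

Lemma evaluation_norm (V : normedModType R) (v : V) : `|evaluation v| <= `|v|.
Proof.
apply: dual_norm_le => f f1; apply: le_trans (ler_norm _) _.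
by apply: le_trans (le_dual_norm f v) _; rewrite ler_piMl.
Qed.

Lemma adjoint_subproof (V W : normedModType R) (T : bounded_op V W)
    (f : dual W) :
  ((fun x => f (T x)) : V -> R^o) \in @bounded_linear_pred R V R^o.
Proof.
apply: mem_set; split; first by move=> a x y; rewrite !linearP.
exists (`|f| * `|T|) => x; apply: le_trans (le_dual_norm _ _) _.
by rewrite -mulrA ler_wpM2l//; exact: le_op_norm.
Qed.

(** The adjoint operator, as a function between the duals. *)
Definition adjoint (V W : normedModType R) (T : bounded_op V W)
    (f : dual W) : dual V :=
  BoundedOp (adjoint_subproof T f).

Lemma adjoint_norm (V W : normedModType R) (T : bounded_op V W) (f : dual W) :
  `|adjoint T f| <= `|f| * `|T|.
Proof.
apply: dual_norm_le => x x1; apply: le_trans (ler_norm _) _.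
apply: le_trans (le_dual_norm f (T x)) _; rewrite ler_wpM2l//.
apply: le_trans (le_op_norm T x) _.
by rewrite ler_piMr// (le_trans _ (normr_ge0 T)).
Qed.

Lemma cvg_harmonic_bound (u : nat -> R) (l M : R) (N : nat) :
  (forall n, (N <= n)%N -> `|u n - l| <= M * harmonic n) -> u @ \oo --> l.
Proof.
move=> H; apply/cvgrPdist_le => e e0.
have /cvgrPdist_le/(_ e e0) : M * harmonic n @[n --> \oo] --> M * (0 : R).
  by apply: cvgMl_tmp; exact: cvg_harmonic.
rewrite mulr0; apply: filterS2 (nbhs_infty_ge N) => n Nn.
rewrite sub0r normrN => hn; apply: le_trans hn; rewrite distrC.
exact: le_trans (H n Nn) (ler_norm _).
Qed.

Lemma dual_cvg (V : normedModType R) (f : dual V) (u : nat -> V) (p : V) :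
  u @ \oo --> p -> f (u n) @[n --> \oo] --> (f p : R).
Proof.
move=> up; apply/cvgrPdist_le => e e0.
have f1 : 0 < `|f| + 1 by rewrite ltr_wpDl.
have /cvgrPdist_le/(_ _ (divr_gt0 e0 f1)) := up.
apply: filterS => n un; rewrite -linearB; apply: le_trans (le_dual_norm _ _) _.
rewrite ler_pdivlMr// in un; apply: le_trans un.
by rewrite mulrC ler_wpM2l// lerDl.
Qed.

(** By completeness, the canonical image of a Banach space is closed in the
    bidual. *)
Lemma bidual_closed (Y : completeNormedModType R) (g : dual (dual Y)) :
  (forall d : R, 0 < d ->
     exists y, forall f : dual Y, `|g f - f y| <= d * `|f|) ->
  exists y, forall f : dual Y, f y = g f.
Proof.
move=> H.
have /choice[y yg] n : exists y, forall f : dual Y,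
    `|g f - f y| <= harmonic n * `|f|.
  by apply: H; exact: harmonic_gt0.
(* the distances are computed with norming functionals *)
have dist n m : `|y n - y m| <= harmonic n + harmonic m.
  have [f [f1 <-]] := norming_functional (y n - y m).
  have {}f1 : `|f| <= 1.
    apply: dual_norm_le => x x1; apply: le_trans x1.
    exact: le_trans (ler_norm _) (f1 x).
  have ge k : `|g f - f (y k)| <= harmonic k.
    by apply: le_trans (yg k f) _; rewrite ler_piMr// harmonic_ge0.
  rewrite linearB; have := ge n; have := ge m; rewrite !ler_norml.
  by move=> /andP[] ? ? /andP[] ? ?; lra.
have /cvg_ex[p yp] : cvg (y @ \oo).
  apply/cauchy_cvgP/cauchy_exP => e e0.
  have e2 : 0 < e / 2 by rewrite divr_gt0.
  have /cvgrPdist_lt/(_ _ e2)[N _ hN] := @cvg_harmonic R.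
  exists (y N); exists N => // n Nn; rewrite -ball_normE /=.
  have hlt k : (N <= k)%N -> harmonic k < e / 2.
    by move=> /hN /=; rewrite sub0r normrN ger0_norm// harmonic_ge0.
  by have := dist N n; have := hlt _ (leqnn N); have := hlt _ Nn; lra.
exists p => f; apply: (@real_cvg_unique R nat \oo (fun n => f (y n))).
  exact: dual_cvg.
apply: (@cvg_harmonic_bound _ _ `|f| 0) => n _.
by rewrite distrC mulrC; exact: yg.
Qed.

End Adjoint.

(** * Weak compactness of an operator from that of its adjoint *)

Section Gantmacher.
Context {R : realType}.

Lemma adjoint_ball_LDP (V W : normedModType R) (T : bounded_op V W) :
  DPcc T -> LDP_set (adjoint T @` [set f | `|f| <= 1]).
Proof.
move=> TDP; split.
  exists `|T|; split; first exact: num_real.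
  move=> M TM _ [f /= f1 <-]; apply: le_trans (adjoint_norm _ _) _.
  by rewrite (le_trans _ (ltW TM))// ler_piMl.
move=> x x0 xDP.
pose E n := [set `|h (x n)| | h in adjoint T @` [set f | `|f| <= 1]].
have E0 n : E n 0.
  by exists (adjoint T 0); [exists 0 => //=; rewrite normr0|rewrite normr0].
have Eub n : ubound (E n) `|T (x n)|.
  move=> _ [_ [f /= f1 <-] <-]; apply: le_trans (le_dual_norm f _) _.
  by rewrite ler_piMl.
have Tx : `|T (x n)| @[n --> \oo] --> (0 : R).
  by rewrite -[X in _ --> X](@normr0 _ W); exact: cvg_norm (TDP x x0 xDP).
apply: (squeeze_cvgr _ (cvg_cst 0) Tx); near=> n; apply/andP; split.
  by apply: ub_le_sup (E0 n); exists `|T (x n)|; exact: Eub.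
by apply: ge_sup (Eub n); exists 0; exact: E0.
Unshelve. all: by end_near. Qed.

(** If a bidual functional [g] stays at distance more than [d] from a space,
    then every finite combination of [g] and evaluations satisfies the
    hypothesis of Helly's theorem for the value [d] at [g] and [0] elsewhere. *)
Lemma helly_bidual (X Y : normedModType R) (T : bounded_op X Y)
    (g : dual (dual Y)) (d : R) (k : option X -> dual (dual Y))
    (c : option X -> R) :
  0 < d -> (forall y, exists f : dual Y, d * `|f| < `|g f - f y|) ->
  k None = g -> c None = d ->
  (forall x, k (Some x) = evaluation (T x)) -> (forall x, c (Some x) = 0) ->
  forall (s : seq (option X)) (a : option X -> R),
  \sum_(j <- s) a j * c j <= `|\sum_(j <- s) a j *: k j|.
Proof.
move=> d0 far kN cN kS cS s a.
have [A [z [-> sumE]]] : exists A z, \sum_(j <- s) a j * c j = A * d /\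
    forall f : dual Y, (\sum_(j <- s) a j *: k j : dual (dual Y)) f =
    A * g f + f z.
  elim: s => [|j s [A [z [cE kE]]]].
    exists 0, 0; rewrite !big_nil mul0r; split=> // f.
    by rewrite mul0r linear0 addr0.
  case: j => [x|].
    exists A, (a (Some x) *: T x + z); rewrite big_cons cE cS mulr0 add0r.
    split=> // f; have := kE f; rewrite !dual_sumE big_cons => ->.
    by rewrite kS linearP/= addrCA.
  exists (a None + A), z; rewrite big_cons cE cN mulrDl; split=> // f.
  by have := kE f; rewrite !dual_sumE big_cons => ->; rewrite kN mulrDl addrA.
have [A0|A0] := leP A 0.
  by rewrite (le_trans _ (normr_ge0 _))// mulr_le0_ge0// ltW.
have [f df] := far (- (A^-1 *: z)).
have f0 : 0 < `|f|.
  rewrite lt_neqAle normr_ge0 andbT eq_sym; apply: contraTN df => /eqP f0.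
  have -> : f = 0 by apply/eqP; rewrite -normr_eq0 f0.
  by rewrite linear0 normr0 mulr0 subr0 normr0 ltxx.
rewrite -(ler_pM2r f0) (le_trans _ (le_dual_norm _ f))// sumE.
have -> : A * g f + f z = A * (g f - f (- (A^-1 *: z))).
  rewrite linearN linearZ opprK mulrDr /= -[_ *: _]/(_ * _) mulrA.
  by rewrite mulfV ?gt_eqF// mul1r.
by rewrite normrM (gtr0_norm A0) -mulrA ler_wpM2l// ltW.
Qed.

(** One half of Gantmacher's theorem. *)
Theorem weakly_compact_of_adjoint (X : normedModType R)
    (Y : completeNormedModType R) (T : bounded_op X Y) :
  relatively_weakly_compact (adjoint T @` [set f | `|f| <= 1]) ->
  weakly_compact_op T.
Proof.
move=> aT; apply: relatively_weakly_compact_image => U UU UB.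
have [phi Uphi] : exists phi : dual (dual X),
    forall h : dual X, h x @[x --> U] --> (phi h : R).
  apply: (@ultra_dual_limit _ _ _ U (@evaluation R X) 1) => //.
  apply: filterS UB => x /= x1; exact: le_trans (evaluation_norm x) x1.
have [g Ug] : exists g : dual (dual Y),
    forall f : dual Y, f (T x) @[x --> U] --> (g f : R).
  apply: (@ultra_dual_limit _ _ _ U (fun x => evaluation (T x)) `|T|) => //.
  apply: filterS UB => x /= x1; apply: le_trans (evaluation_norm _) _.
  apply: le_trans (le_op_norm T x) _.
  by rewrite ler_piMr// (le_trans _ (normr_ge0 T)).
have gE f : phi (adjoint T f) = g f.
  exact: (@real_cvg_unique R X U (fun x => f (T x)) _ _ _
    (Uphi (adjoint T f)) (Ug f)).
suff [y yg] : exists y, forall f : dual Y, f y = g f.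
  by exists y => f; rewrite yg; exact: Ug.
apply: bidual_closed => d d0; apply: contrapT => nd.
have far y : exists f : dual Y, d * `|f| < `|g f - f y|.
  apply: contrapT => nf; apply: nd; exists y => f; rewrite leNgt.
  by apply/negP => df; apply: nf; exists f.
pose k (j : option X) := if j is Some x then evaluation (T x) else g.
pose c (j : option X) := if j is Some _ then 0 else d.
have H := @helly_bidual X Y T g d k c d0 far erefl erefl (fun=> erefl)
  (fun=> erefl).
(* a family of functionals in the ball, tending to 0 on the range of T while
   their values under g tend to d *)
have [W [WW WB Wk]] := ultra_of_approx (fun s e e0 => helly (H s) e0).
have [h Wh] := relatively_weakly_compact_ultra aT WW
  (filterS (fun f f1 => ex_intro2 _ _ f f1 erefl) WB : W (adjoint T @^-1` _)).
have h0 : h = 0.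
  apply/val_inj/funext => x.
  exact: (@real_cvg_unique R _ W (fun f => f (T x)) _ _ _
    (Wh (evaluation x)) (Wk (Some x))).
have : phi h = d.
  apply: (@real_cvg_unique R _ W (fun f => phi (adjoint T f)) _ _ _ (Wh phi)).
  by under eq_cvg do rewrite gE; exact: (Wk None).
by move=> E; move: d0; rewrite -E h0 linear0 ltxx.
Qed.

End Gantmacher.

(** * Operators into the space of bounded sequences *)

Section EllInfty.
Context {R : realType} {V : normedModType R}.

Lemma coordinate_operator (f : nat -> dual V) (M : R) :
  (forall n, `|f n| <= M) ->
  exists T : bounded_op V (ell_infty R), forall x n, T x n = f n x.
Proof.
move=> fM.
have fb x n : `|f n x| <= M * `|x|.
  by apply: le_trans (le_dual_norm _ _) _; rewrite ler_wpM2r.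
have Tb x : (fun n => f n x : R^o) \in @bounded_seq_pred R.
  by apply/bounded_seqP; exists (M * `|x|) => n; exact: fb.
pose T x := EllInfty (Tb x).
have TP : T \in @bounded_linear_pred R V (ell_infty R).
  apply: mem_set; split.
    by move=> a x y; apply/val_inj/funext => n /=; rewrite linearP.
  by exists M => x; apply: sup_norm_le => n; exact: fb.
by exists (BoundedOp TP).
Qed.

Lemma ell_infty_coord (n : nat) :
  exists p : dual (ell_infty R), (forall u, p u = u n) /\ `|p| <= 1.
Proof.
have [||u|p pE] := @dual_build R (ell_infty R) (fun u => u n) 1.
- by [].
- by [].
- by rewrite mul1r; exact: le_sup_norm.
exists p; split=> //; apply: dual_norm_le => u u1; rewrite pE.
by apply: le_trans (ler_norm _) _; apply: le_trans u1; exact: le_sup_norm.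
Qed.

Lemma coordinate_operator_DPcc (A : set (dual V)) (f : nat -> dual V)
    (T : bounded_op V (ell_infty R)) :
  LDP_set A -> (forall n, A (f n)) -> (forall x n, T x n = f n x) -> DPcc T.
Proof.
move=> [[M0 [_ HM]] AL] Af TE x x0 xDP; have Ax := AL x x0 xDP.
have AM h : A h -> `|h| <= M0 + 1 by move=> Ah; apply: HM => //; rewrite ltrDl.
apply/cvgr0Pnorm_le => e e0; have /cvgr0Pnorm_le/(_ e e0) := Ax.
apply: filterS => k xk; apply: sup_norm_le => n; rewrite TE.
apply: le_trans xk; apply: le_trans (ler_norm _).
apply: ub_le_sup; last by exists (f n).
exists ((M0 + 1) * `|x k|) => _ [h Ah <-].
by apply: le_trans (le_dual_norm _ _) _; rewrite ler_wpM2r// AM.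
Qed.

End EllInfty.

(** * Bounded sets of functionals detected by sequences *)

(** Recursive choice of a sequence whose terms depend on all the previous
    ones. *)
Lemma history_choice (Q : Type) (step : seq Q -> Q -> Prop) :
  (forall s, exists q, step s q) ->
  exists q : nat -> Q, forall n, step (mkseq q n) (q n).
Proof.
move=> /choice[pick pickP].
pose S := fix S n := if n is m.+1 then rcons (S m) (pick (S m)) else [::].
exists (fun n => pick (S n)) => n.
have -> : mkseq (fun n => pick (S n)) n = S n; last exact: pickP.
by elim: n => // n IH; rewrite mkseqS IH.
Qed.

Section Interlacing.
Context {R : realType} {X : normedModType R}.

(** Goldstine's theorem: the unit ball is weak-star dense in the bidual ball. *)
Lemma goldstine (phi : dual (dual X)) (s : seq (dual X)) (e : R) :
  `|phi| <= 1 -> 0 < e ->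
  exists x, `|x| <= 1 /\ forall h, h \in s -> `|h x - phi h| <= e.
Proof.
move=> phi1 e0; apply: (@helly _ _ _ s id phi _ e e0) => a.
have <- : phi (\sum_(j <- s) a j *: j) = \sum_(j <- s) a j * phi j.
  by rewrite linear_sum; apply: eq_bigr => j _; rewrite linearZ.
apply: le_trans (ler_norm _) _; apply: le_trans (le_dual_norm _ _) _.
by rewrite ler_piMl.
Qed.

(** If the limits of [A] along an ultrafilter, at a point [phi] of the bidual
    ball on the one hand and at the points of [X] on the other, are [l] and
    [f0], then two sequences in the ball and in [A] realize both iterated
    limits. *)
Lemma interlaced_sequences (A : set (dual X)) (U : set_system (dual X))
    (phi : dual (dual X)) (f0 : dual X) (l : R) :
  ProperFilter U -> U A -> `|phi| <= 1 ->
  (forall x, (f : dual X) x @[f --> U] --> (f0 x : R)) ->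
  phi f @[f --> U] --> l ->
  exists (x : nat -> X) (f : nat -> dual X),
  [/\ forall m, `|x m| <= 1, forall n, A (f n),
      forall n, f n (x m) @[m --> \oo] --> (phi (f n) : R),
      forall m, f n (x m) @[n --> \oo] --> (f0 (x m) : R) &
      f0 (x m) @[m --> \oo] --> (phi f0 : R) /\
      phi (f n) @[n --> \oo] --> l].
Proof.
move=> UP UA phi1 Uf0 Ul.
have approx (s : seq X) (e : R) : 0 < e -> exists f : dual X,
    [/\ A f, `|phi f - l| <= e & forall x, x \in s -> `|f x - f0 x| <= e].
  move=> e0.
  have Us : U [set f : dual X | forall x, x \in s -> `|f x - f0 x| <= e].
    elim: s => [|y s IH]; first exact: filterS filterT.
    have /cvgrPdist_le/(_ e e0) := Uf0 y.
    apply: filterS2 IH => f fs fy x.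
    by rewrite inE => /predU1P[->|]; [rewrite distrC|exact: fs].
  have /cvgrPdist_le/(_ e e0) Ue := Ul.
  have [f [[Af fs] fl]] := filter_ex (filterI (filterI UA Us) Ue).
  by exists f; split=> //; rewrite distrC.
pose step (s : seq (X * dual X)) (q : X * dual X) :=
  let e := harmonic (size s) in
  [/\ `|q.1| <= 1, A q.2, `|f0 q.1 - phi f0| <= e /\ `|phi q.2 - l| <= e,
      forall p, p \in s -> `|p.2 q.1 - phi p.2| <= e &
      forall p, p \in s -> `|q.2 p.1 - f0 p.1| <= e].
have [|q qP] := @history_choice _ step.
  move=> s; have e0 : 0 < harmonic (size s) :> R by exact: harmonic_gt0.
  have [x [x1 xs]] := goldstine (f0 :: map snd s) phi1 e0.
  have [f [Af fl fs]] := approx (map fst s) _ e0.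
  exists (x, f); split=> //=; first by split=> //; apply: xs; rewrite mem_head.
    by move=> p ps; apply: xs; rewrite inE map_f ?orbT.
  by move=> p ps; apply: fs; rewrite map_f.
have mem i n : (i < n)%N -> q i \in mkseq q n.
  by move=> lt_in; apply: map_f; rewrite mem_iota.
exists (fun m => (q m).1), (fun n => (q n).2); split.
- by move=> m; case: (qP m).
- by move=> n; case: (qP n).
- move=> n; apply: (@cvg_harmonic_bound _ _ _ 1 n.+1) => m nm.
  have [_ _ _ + _] := qP m; rewrite mul1r size_mkseq; apply; exact: mem.
- move=> m; apply: (@cvg_harmonic_bound _ _ _ 1 m.+1) => n mn.
  have [_ _ _ _] := qP n; rewrite mul1r size_mkseq; apply; exact: mem.
by split; apply: (@cvg_harmonic_bound _ _ _ 1 0) => n _; rewrite mul1r;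
  have [_ _ []] := qP n; rewrite size_mkseq.
Qed.

(** An L-Dunford-Pettis set is relatively weakly compact when all the
    Dunford-Pettis completely continuous operators into the space of bounded
    sequences are weakly compact. *)
Theorem LDP_relatively_weakly_compact (A : set (dual X)) :
  (forall T : bounded_op X (ell_infty R), DPcc T -> weakly_compact_op T) ->
  LDP_set A -> relatively_weakly_compact A.
Proof.
move=> H AL; have [[M0 [_ HM]] _] := AL.
have AM h : A h -> `|h| <= M0 + 1 by move=> Ah; apply: HM => //; rewrite ltrDl.
rewrite -[A]image_id; apply: relatively_weakly_compact_image => U UU UA.
have [f0 Uf0] := ultra_dual_limit UU (filterS AM UA).
have [G UG] : exists G : dual (dual (dual X)),
    forall phi : dual (dual X), phi f @[f --> U] --> (G phi : R).
  apply: (@ultra_dual_limit _ _ _ U (@evaluation R (dual X)) (M0 + 1)) => //.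
  by apply: filterS UA => f Af; apply: le_trans (evaluation_norm f) (AM f Af).
have main phi : `|phi| <= 1 -> G phi = phi f0.
  move=> phi1.
  have [x [f [x1 Af fx_phi fx_f0 [f0x phif]]]] :=
    interlaced_sequences _ UA phi1 Uf0 (UG phi).
  have [T TE] := coordinate_operator (fun n => AM _ (Af n)).
  have Twc := H T (coordinate_operator_DPcc AL Af TE).
  have [W [WW oW]] := ultraFilterLemma (eventually_filter).
  have toW (u : nat -> R) (l : R) : u @ \oo --> l -> u @ W --> l.
    by move=> ul B /ul; exact: oW.
  have WT : W ((T \o x) @^-1` (T @` [set v | `|v| <= 1])).
    by apply: filterS filterT => m _; exists (x m); [exact: x1|].
  have [z Wz] := relatively_weakly_compact_ultra Twc WW WT.
  have /choice[p pP] := @ell_infty_coord R.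
  have zE n : z n = phi (f n).
    have := Wz (p n); rewrite (pP n).1 => h1.
    apply: (real_cvg_unique _ h1); apply: toW.
    under eq_cvg do rewrite (pP n).1 /= TE.
    exact: fx_phi.
  (* the limit along W is a functional on bounded sequences *)
  have [L WL] : exists L : dual (ell_infty R),
      forall u, p n u @[n --> W] --> (L u : R).
    apply: (@ultra_dual_limit _ _ _ W p 1) => //.
    by apply: filterS filterT => n _; exact: (pP n).2.
  have LT m : L (T (x m)) = f0 (x m).
    apply: (real_cvg_unique _ (WL (T (x m)))); apply: toW.
    under eq_cvg do rewrite (pP _).1 TE.
    exact: fx_f0.
  have Lz : L z = G phi.
    apply: (real_cvg_unique _ (WL z)); apply: toW.
    under eq_cvg do rewrite (pP _).1 zE.
    exact: phif.
  rewrite -Lz; apply: (real_cvg_unique _ (Wz L)); apply: toW.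
  by under eq_cvg do rewrite /= LT.
exists f0 => phi.
(* scale phi into the ball *)
have c0 : 0 < `|phi| + 1 by rewrite ltr_wpDl.
suff -> : phi f0 = G phi by exact: UG.
have : G ((`|phi| + 1)^-1 *: phi) = ((`|phi| + 1)^-1 *: phi) f0.
  apply: main; rewrite normrZ gtr0_norm ?invr_gt0//.
  by rewrite ler_pdivrMl// mulr1 lerDl.
rewrite linearZ /= => /(congr1 (fun r => (`|phi| + 1) * r)).
have E (r : R) : (`|phi| + 1) * ((`|phi| + 1)^-1 * r) = r.
  by rewrite mulrA mulfV ?gt_eqF// mul1r.
by move=> h; rewrite -[LHS]E -[RHS]E; apply/esym.
Qed.

End Interlacing.

(** * Characterization of the L-Dunford-Pettis property *)

Theorem theorem2p7 (R : realType) (X : completeNormedModType R) :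
  [<-> LDP_property X;
       forall (Y : completeNormedModType R) (T : bounded_op X Y),
         DPcc T -> weakly_compact_op T;
       forall T : bounded_op X (ell_infty R),
         DPcc T -> weakly_compact_op T].
Proof.
tfae.
- move=> XL Y T TDP; apply: weakly_compact_of_adjoint; apply: XL.
  exact: adjoint_ball_LDP.
- by move=> H T; exact: H.
- by move=> H A; exact: LDP_relatively_weakly_compact.
Qed.
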